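(* Let $A$ and $B$ be finite dimensional algebras over a field $k$. If $A$ separably divides $B$, then $\operatorname{cx}(A) \leq \operatorname{cx}(B)$. If $A$ and $B$ are separably equivalent, then $\operatorname{cx}(A) = \operatorname{cx}(B)$.
   Context: Algebras are associative and unital; modules are finitely generated right modules unless otherwise stated, and $k$ acts centrally on all bimodules. Separable division and equivalence: $A$ separably divides $B$ if there are bimodules ${}_AM_B$ and ${}_BN_A$, each finitely generated and projective as a left module and as a right module, such that $A$ is a direct summand of $M\otimes_B N$ as an $A$-$A$-bimodule. $A$ and $B$ are separably equivalent if there are bimodules ${}_AM_B$, ${}_BN_A$, each finitely generated and projective on each side, together with bimodules ${}_AX_A$, ${}_BY_B$ and bimodule isomorphisms $M\otimes_B N\cong A\oplus X$ and $N\otimes_A M\cong B\oplus Y$. Complexity: for a projective resolution $P_*=(\cdots\to P_1\to P_0)\to M\to 0$ of an $A$-module $M$, the complexity $\operatorname{cx}(P_* )$ is the smallest integer $d\ge 0$ such that for some $\lambda\in\mathbb{N}$ one has $\dim_k P_n\leq \lambda n^{d-1}$ for all $n\geq 1$, and $\operatorname{cx}(P_* )=\infty$ if there is no such $d$. The complexity $\operatorname{cx}(M)$ of $M$ is the complexity of a minimal projective resolution of $M$. The complexity $\operatorname{cx}(A)$ of the algebra is the maximum of $\operatorname{cx}(M)$ over all (finitely generated) $A$-modules $M$. *)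

(* Defs.v *)
From HB Require Import structures.
From mathcomp Require Import all_boot all_order all_algebra all_field.
From mathcomp Require Import boolp constructive_ereal.

Set Implicit Arguments.
Unset Strict Implicit.
Unset Printing Implicit Defensive.

Import Order.TTheory GRing.Theory Num.Theory.
Local Open Scope ring_scope.

(* A finitely generated module over a finite-dimensional k-algebra is the     *)
(* same thing as a module that is finite-dimensional over k, and then so are  *)
(* its tensor products, direct sums and direct summands. Modules are thus     *)
(* actions on a vectType k, and every module below is finitely generated.     *)
(* Both actions of a bimodule are k-bilinear for one and the same k-structure *)
(* on the carrier: this is what "k acts centrally" means.                     *)

Definition is_ract (k : fieldType) (A : falgType k) (V : vectType k)
    (act : V -> A -> V) : Prop :=
  [/\ forall a, linear (act^~ a),
      forall x, linear (act x),
      forall x, act x 1 = x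
    & forall x a b, act x (a * b) = act (act x a) b].

Definition is_lact (k : fieldType) (A : falgType k) (V : vectType k)
    (act : A -> V -> V) : Prop :=
  [/\ forall a, linear (act a),
      forall x, linear (act^~ x),
      forall x, act 1 x = x
    & forall a b x, act (a * b) x = act a (act b x)].

Record rmodule (k : fieldType) (A : falgType k) := RModule {
  rmodule_sort :> vectType k;
  ract : rmodule_sort -> A -> rmodule_sort;
  ractP : is_ract ract }.

Record lmodule (k : fieldType) (A : falgType k) := LModule {
  lmodule_sort :> vectType k;
  lact : A -> lmodule_sort -> lmodule_sort;
  lactP : is_lact lact }.

Record bimodule (k : fieldType) (A B : falgType k) := Bimodule {
  bimodule_sort :> vectType k;
  blact : A -> bimodule_sort -> bimodule_sort;
  bract : bimodule_sort -> B -> bimodule_sort;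
  blactP : is_lact blact;
  bractP : is_ract bract;
  blractA : forall a x b, blact a (bract x b) = bract (blact a x) b }.

Definition left_restr (k : fieldType) (A B : falgType k) (M : bimodule A B) :
  lmodule A := LModule (blactP M).

Definition right_restr (k : fieldType) (A B : falgType k) (M : bimodule A B) :
  rmodule B := RModule (bractP M).

Definition is_rhom (k : fieldType) (A : falgType k) (M N : rmodule A)
    (f : 'Hom(M, N)) : Prop :=
  forall x a, f (ract x a) = ract (f x) a.

Definition is_lhom (k : fieldType) (A : falgType k) (M N : lmodule A)
    (f : 'Hom(M, N)) : Prop :=
  forall a x, f (lact a x) = lact a (f x).

Definition is_bihom (k : fieldType) (A B : falgType k) (M N : bimodule A B)
    (f : 'Hom(M, N)) : Prop :=
  (forall a x, f (blact a x) = blact a (f x)) /\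
  (forall x b, f (bract x b) = bract (f x) b).

Definition biiso (k : fieldType) (A B : falgType k) (M N : bimodule A B) :
    Prop :=
  exists2 f : 'Hom(M, N), is_bihom f & bijective f.

Definition rprojective (k : fieldType) (A : falgType k) (P : rmodule A) :
    Prop :=
  forall (X Y : rmodule A) (g : 'Hom(X, Y)) (f : 'Hom(P, Y)),
    is_rhom g -> is_rhom f -> limg g = fullv ->
  exists2 h : 'Hom(P, X), is_rhom h & (g \o h)%VF = f.

Definition lprojective (k : fieldType) (A : falgType k) (P : lmodule A) :
    Prop :=
  forall (X Y : lmodule A) (g : 'Hom(X, Y)) (f : 'Hom(P, Y)),
    is_lhom g -> is_lhom f -> limg g = fullv ->
  exists2 h : 'Hom(P, X), is_lhom h & (g \o h)%VF = f.

Definition biprojective (k : fieldType) (A B : falgType k)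
    (M : bimodule A B) : Prop :=
  lprojective (left_restr M) /\ rprojective (right_restr M).

Section RegularBimodule.
Variables (k : fieldType) (A : falgType k).

Lemma regular_is_lact : @is_lact k A A ( *%R ).
Proof.
split=> [a c x y|x c a b|x|a b x].
- by rewrite mulrDr scalerAr.
- by rewrite /= mulrDl scalerAl.
- exact: mul1r.
- by rewrite mulrA.
Qed.

Lemma regular_is_ract : @is_ract k A A ( *%R ).
Proof.
split=> [a c x y|x c a b|x|x a b].
- by rewrite /= mulrDl scalerAl.
- by rewrite mulrDr scalerAr.
- exact: mulr1.
- by rewrite mulrA.
Qed.

Definition regular_bimodule : bimodule A A :=
  Bimodule regular_is_lact regular_is_ract (@mulrA A).

End RegularBimodule.

Section DirectSum.
Variables (k : fieldType) (A B : falgType k) (M N : bimodule A B).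

Let sum_lact (a : A) (u : (M * N)%type) : (M * N)%type :=
  (blact a u.1, blact a u.2).
Let sum_ract (u : (M * N)%type) (b : B) : (M * N)%type :=
  (bract u.1 b, bract u.2 b).

Lemma bidirsum_is_lact : is_lact sum_lact.
Proof.
have [M1 M2 M3 M4] := blactP M; have [N1 N2 N3 N4] := blactP N.
split=> [a c [x1 x2] [y1 y2]|[x1 x2] c a b|[x1 x2]|a b [x1 x2]].
- by congr pair; [apply: M1 | apply: N1].
- by congr pair; [apply: M2 | apply: N2].
- by rewrite /sum_lact /= M3 N3.
- by rewrite /sum_lact /= M4 N4.
Qed.

Lemma bidirsum_is_ract : is_ract sum_ract.
Proof.
have [M1 M2 M3 M4] := bractP M; have [N1 N2 N3 N4] := bractP N.
split=> [a c [x1 x2] [y1 y2]|[x1 x2] c a b|[x1 x2]|[x1 x2] a b].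
- by congr pair; [apply: M1 | apply: N1].
- by congr pair; [apply: M2 | apply: N2].
- by rewrite /sum_ract /= M3 N3.
- by rewrite /sum_ract /= M4 N4.
Qed.

Lemma bidirsum_actA a u b : sum_lact a (sum_ract u b) = sum_ract (sum_lact a u) b.
Proof. by rewrite /sum_lact /sum_ract /= !blractA. Qed.

Definition bidirsum : bimodule A B :=
  Bimodule bidirsum_is_lact bidirsum_is_ract bidirsum_actA.

End DirectSum.

Definition balanced (k : fieldType) (A B C : falgType k)
    (M : bimodule A B) (N : bimodule B C) (G : zmodType) (f : M -> N -> G) :
    Prop :=
  [/\ forall x x' y, f (x + x') y = f x y + f x' y,
      forall x y y', f x (y + y') = f x y + f x y'
    & forall x b y, f (bract x b) y = f x (blact b y)].

(* T, with pure tensors t x y, is the A-C-bimodule M (x)_B N. Compatibility   *)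
(* of t with scalars of k follows from its compatibility with the A-action.   *)
Definition is_tensor (k : fieldType) (A B C : falgType k)
    (M : bimodule A B) (N : bimodule B C) (T : bimodule A C)
    (t : M -> N -> T) : Prop :=
  [/\ balanced t,
      forall a x y, blact a (t x y) = t (blact a x) y,
      forall x y c, bract (t x y) c = t x (bract y c)
    & forall (G : zmodType) (f : M -> N -> G), balanced f ->
        (exists g : {additive T -> G}, forall x y, g (t x y) = f x y) /\
        (forall g g' : {additive T -> G},
           (forall x y, g (t x y) = f x y) ->
           (forall x y, g' (t x y) = f x y) -> g =1 g')].

Definition tensor_iso (k : fieldType) (A B C : falgType k)
    (M : bimodule A B) (N : bimodule B C) (Z : bimodule A C) : Prop :=
  exists (T : bimodule A C) (t : M -> N -> T), is_tensor t /\ biiso T Z.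

Definition separably_divides (k : fieldType) (A B : falgType k) : Prop :=
  exists (M : bimodule A B) (N : bimodule B A),
    [/\ biprojective M, biprojective N
      & exists X : bimodule A A,
          tensor_iso M N (bidirsum (regular_bimodule A) X)].

Definition separably_equivalent (k : fieldType) (A B : falgType k) : Prop :=
  exists (M : bimodule A B) (N : bimodule B A),
    [/\ biprojective M, biprojective N,
        exists X : bimodule A A,
          tensor_iso M N (bidirsum (regular_bimodule A) X)
      & exists Y : bimodule B B,
          tensor_iso N M (bidirsum (regular_bimodule B) Y)].

Record projective_resolution (k : fieldType) (A : falgType k)
    (M : rmodule A) := ProjectiveResolution {
  res_term :> nat -> rmodule A;
  res_diff : forall n, 'Hom(res_term n.+1, res_term n);
  res_aug : 'Hom(res_term 0%N, M);
  res_projective : forall n, rprojective (res_term n);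
  res_diff_hom : forall n, is_rhom (res_diff n);
  res_aug_hom : is_rhom res_aug;
  res_aug_surj : limg res_aug = fullv;
  res_exact0 : limg (res_diff 0%N) = lker res_aug;
  res_exactS : forall n, limg (res_diff n.+1) = lker (res_diff n) }.

Definition is_submodule (k : fieldType) (A : falgType k) (M : rmodule A)
    (U : {vspace M}) : Prop :=
  forall u a, u \in U -> ract u a \in U.

Definition superfluous (k : fieldType) (A : falgType k) (M : rmodule A)
    (K : {vspace M}) : Prop :=
  forall U : {vspace M}, is_submodule U -> (K + U)%VS = fullv -> U = fullv.

(* Each map of the resolution is a projective cover of its image. *)
Definition minimal_resolution (k : fieldType) (A : falgType k)
    (M : rmodule A) (P : projective_resolution M) : Prop :=
  superfluous (lker (res_aug P)) /\
  forall n, superfluous (lker (res_diff P n)).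

Definition least_or_oo (p : nat -> Prop) : \bar int :=
  if pselect (exists d, `[< p d >]) is left ex then (ex_minn ex)%:Z%:E
  else +oo%E.

(* The exponent d - 1 is an integer, equal to -1 for d = 0.                   *)
Definition cx_resolution (k : fieldType) (A : falgType k) (M : rmodule A)
    (P : projective_resolution M) : \bar int :=
  least_or_oo (fun d => exists lambda : nat, forall n : nat, (1 <= n)%N ->
    (\dim {:P n})%:R <= lambda%:R * n%:R ^ (d%:Z - 1) :> rat).

(* Minimal projective resolutions of M exist and are isomorphic, so that at   *)
(* most one d satisfies the condition.                                        *)
Definition cx_module (k : fieldType) (A : falgType k) (M : rmodule A) :
    \bar int :=
  least_or_oo (fun d => exists2 P : projective_resolution M,
    minimal_resolution P & cx_resolution P = d%:Z%:E).

(* The maximum of the cx_module M: they are natural numbers or +oo, so their  *)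
(* least finite upper bound is attained, and +oo stands for unboundedness.    *)
Definition cx_algebra (k : fieldType) (A : falgType k) : \bar int :=
  least_or_oo (fun d => forall M : rmodule A, (cx_module M <= d%:Z%:E)%E).

(* Main.v *)
From HB Require Import structures.
Require Import Defs.
From mathcomp Require Import all_boot all_order all_algebra all_field.
From mathcomp Require Import boolp constructive_ereal.

Set Implicit Arguments.
Unset Strict Implicit.
Unset Printing Implicit Defensive.

Import Order.TTheory GRing.Theory Num.Theory.
Local Open Scope ring_scope.

(** Let [U] be an [A]-module. Since [A] is a bimodule summand of [M (x)_B N],
    [U] is a direct summand of [(U (x)_A M) (x)_B N] ([separable_retract]).
    Take a minimal projective resolution [Q] of the [B]-module [U (x)_A M].
    As [N] is projective on the left, hence flat, and projective on the right,
    [Q (x)_B N] is a projective resolution over [A] of [(U (x)_A M) (x)_B N]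
    ([tensor_resolution]), and the dimensions of its terms exceed those of [Q]
    by at most a constant factor ([tensor_dim]). A minimal resolution of the
    direct summand [U] has terms of no larger dimension
    ([minimal_resolution_dim]), so it grows at most as fast as [Q] does. Hence
    every bound for the complexity of all [B]-modules is one for all
    [A]-modules. Separable equivalence is division both ways round.

    Two ingredients are built by hand. Tensor products are only needed with a
    bimodule that is projective on the left; a dual basis then realizes
    [U (x)_A M] as a direct summand of a power of [U], for which exactness, the
    universal property and the bound on the dimension are all explicit.
    Projective covers are surjections from a projective module of least
    dimension ([projective_cover]); iterating them on kernels yields minimal
    resolutions ([cover_resolution]). *)

(** * Linear maps, submodules and lifting *)

Section LinearMaps.
Variable k : fieldType.

Lemma linfunP (U V : vectType k) (f : U -> V) : linear f -> linfun f =1 f.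
Proof.
move=> lf x; pose fL := GRing.isLinear.Build k U V _ f lf.
pose F : {linear U -> V} := HB.pack f fL.
exact: (lfunE F).
Qed.

Lemma limgP (U V : vectType k) (f : 'Hom(U, V)) (y : V) :
  reflect (exists x, y = f x) (y \in limg f).
Proof.
apply: (iffP memv_imgP) => [[x _ ->]|[x ->]]; first by exists x.
by exists x; rewrite ?memvf.
Qed.

Lemma limg_fullP (U V : vectType k) (f : 'Hom(U, V)) :
  limg f = fullv <-> forall y, exists x, y = f x.
Proof.
split=> [fF y|fsurj]; first by apply/limgP; rewrite fF memvf.
by apply/vspaceP => y; rewrite memvf; apply/limgP/fsurj.
Qed.

(** Over a field every linearly closed predicate is a subspace: take one of
    maximal dimension among those that satisfy it. *)
Lemma vspace_of_closed (V : vectType k) (p : V -> Prop) :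
  p 0 -> (forall c x y, p x -> p y -> p (c *: x + y)) ->
  exists U : {vspace V}, forall x, x \in U <-> p x.
Proof.
move=> p0 pL.
pose q d :=
  `[< exists2 U : {vspace V}, \dim U = d & forall x, x \in U -> p x >].
have exq : exists d, q d.
  exists 0%N; apply/asboolP; exists 0%VS; first exact: dimv0.
  by move=> x; rewrite memv0 => /eqP->.
have ubq d : q d -> (d <= \dim {:V})%N.
  by move=> /asboolP[U <- _]; apply/dimvS/subvf.
case: (ex_maxnP exq ubq) => d /asboolP[U dU Up] maxd.
exists U => x; split=> [|px]; first exact: Up.
have /maxd : q (\dim (<[x]> + U)%VS).
  apply/asboolP; exists (<[x]> + U)%VS => // z /memv_addP[u /vlineP[c ->]].
  by move=> [v vU ->]; apply: pL => //; apply: Up.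
rewrite -dU => le; have sU : (U <= <[x]> + U)%VS by apply: addvSr.
have /eqP-> : U == (<[x]> + U)%VS by rewrite eqEdim sU.
by rewrite (subvP (addvSl _ _)) // memv_line.
Qed.

Lemma endo_surj_lker0 (V : vectType k) (f : 'Hom(V, V)) :
  limg f = fullv -> lker f = 0%VS.
Proof.
move=> fF; apply/eqP; rewrite -dimv_eq0; have /eqP := limg_ker_dim f fullv.
by rewrite fF capfv -[X in _ == X]add0n eqn_add2r.
Qed.

End LinearMaps.

Section ModuleTheory.
Variables (k : fieldType) (A : falgType k).
Implicit Types M N X Y P Q : rmodule A.

Lemma ract_linear M a : linear (fun x : M => ract x a).
Proof. by case: (ractP M) => + _ _ _; apply. Qed.

Lemma ract_linear_r M (x : M) : linear (ract x).
Proof. by case: (ractP M) => _ + _ _; apply. Qed.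

Lemma ract1 M (x : M) : ract x 1 = x.
Proof. by case: (ractP M). Qed.

Lemma ractM M (x : M) a b : ract x (a * b) = ract (ract x a) b.
Proof. by case: (ractP M). Qed.

Lemma is_rhom_comp M N X (g : 'Hom(N, X)) (f : 'Hom(M, N)) :
  is_rhom g -> is_rhom f -> is_rhom (g \o f)%VF.
Proof. by move=> gH fH x a; rewrite !comp_lfunE fH gH. Qed.

Lemma is_rhom_inv M N (f : 'Hom(M, N)) :
  is_rhom f -> lker f = 0%VS -> limg f = fullv -> is_rhom (f^-1)%VF.
Proof.
move=> fH k0 fF x a; have /limg_fullP/(_ x)[y ->] := fF.
by rewrite -fH !lker0_lfunK ?k0 ?eqxx.
Qed.

Lemma limg_submodule M N (f : 'Hom(M, N)) : is_rhom f -> is_submodule (limg f).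
Proof.
by move=> fH u a /limgP[x ->]; rewrite -fH; apply/limgP; exists (ract x a).
Qed.

Lemma ractD M a : {morph (fun x : M => ract x a) : x y / x + y}.
Proof. by move=> x y; have := ract_linear a 1 x y; rewrite !scale1r. Qed.

Lemma ract0 M a : ract (0 : M) a = 0.
Proof. by apply: (addrI (ract (0 : M) a)); rewrite -ractD !addr0. Qed.

Lemma ract_suml M a I r (p : pred I) (F : I -> M) :
  ract (\sum_(i <- r | p i) F i) a = \sum_(i <- r | p i) ract (F i) a.
Proof. exact: (big_morph _ (ractD a) (ract0 M a)). Qed.

Lemma ractDr M (x : M) : {morph ract x : a b / a + b}.
Proof. by move=> a b; have := ract_linear_r x 1 a b; rewrite !scale1r. Qed.

Lemma ract0r M (x : M) : ract x 0 = 0.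
Proof. by apply: (addrI (ract x 0)); rewrite -ractDr !addr0. Qed.

Lemma ractZr M (x : M) c a : ract x (c *: a) = c *: ract x a.
Proof. by have := ract_linear_r x c a 0; rewrite ract0r !addr0. Qed.

Lemma lker_submodule M N (f : 'Hom(M, N)) : is_rhom f -> is_submodule (lker f).
Proof. by move=> fH u a; rewrite !memv_ker fH => /eqP->; rewrite ract0. Qed.

Section Submodule.
Variables (M : rmodule A) (U : {vspace M}) (sU : is_submodule U).

Definition sub_act (x : subvs_of U) (a : A) : subvs_of U :=
  vsproj U (ract (vsval x) a).

Lemma sub_actE x a : vsval (sub_act x a) = ract (vsval x) a.
Proof. by rewrite vsprojK // sU // subvsP. Qed.

Lemma sub_act_is_ract : is_ract sub_act.
Proof.
split=> [a c x y|x c a b|x|x a b]; apply: subvs_inj;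
  rewrite ?linearP /= !sub_actE ?linearP /=.
- exact: ract_linear.
- exact: ract_linear_r.
- exact: ract1.
- exact: ractM.
Qed.

Definition submod : rmodule A := RModule sub_act_is_ract.

Definition subincl : 'Hom(submod, M) := linfun (vsval : subvs_of U -> M).

Lemma subinclE (x : submod) : subincl x = vsval x.
Proof. exact: lfunE. Qed.

Lemma subincl_proj x : x \in U -> subincl (vsproj U x) = x.
Proof. by move=> xU; rewrite subinclE; apply: vsprojK. Qed.

Lemma subincl_hom : is_rhom subincl.
Proof. by move=> x a; rewrite !subinclE; apply: sub_actE. Qed.

Lemma subincl_inj : injective subincl.
Proof. by move=> x y; rewrite !subinclE; apply: subvs_inj. Qed.

Lemma limg_subincl : limg subincl = U.
Proof.
apply/vspaceP => x; apply/limgP/idP => [[y ->]|xU].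
  by rewrite subinclE subvsP.
by exists (vsproj U x); rewrite subincl_proj.
Qed.

Lemma corestrict X (f : 'Hom(X, M)) : is_rhom f -> (limg f <= U)%VS ->
  exists2 g : 'Hom(X, submod), is_rhom g & (subincl \o g)%VF = f.
Proof.
move=> fH sf; have fU x : f x \in U.
  by apply: (subvP sf); apply/limgP; exists x.
have gl : linear (fun x => vsproj U (f x) : submod) by move=> c x y; rewrite !linearP.
have gE x : vsval (linfun (fun x => vsproj U (f x) : submod) x) = f x.
  by rewrite linfunP // vsprojK.
exists (linfun (fun x => vsproj U (f x) : submod)).
  by move=> x a; apply: subvs_inj; rewrite sub_actE !gE fH.
by apply/lfunP => x; rewrite lfunE /= subinclE gE.
Qed.

End Submodule.

(** The definition of projectivity only speaks of surjections; one lifts along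
    a map that is not surjective by corestricting to its image. *)
Lemma rprojective_lift P X Y (g : 'Hom(X, Y)) (f : 'Hom(P, Y)) :
  rprojective P -> is_rhom g -> is_rhom f -> (limg f <= limg g)%VS ->
  exists2 h : 'Hom(P, X), is_rhom h & (g \o h)%VF = f.
Proof.
move=> prP gH fH sfg; have sU := limg_submodule gH.
have [g' g'H g'E] := corestrict sU gH (subvv _).
have [f' f'H f'E] := corestrict sU fH sfg.
have g'x x : subincl sU (g' x) = g x by move/lfunP: g'E => <-; rewrite comp_lfunE.
have f'x x : subincl sU (f' x) = f x by move/lfunP: f'E => <-; rewrite comp_lfunE.
have [|h hH hE] := prP _ _ g' f' g'H f'H.
  apply/limg_fullP => y; have /limgP[x xE] := subvsP y.
  by exists x; apply: (subincl_inj (sU := sU)); rewrite g'x -xE subinclE.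
exists h => //; apply/lfunP => x.
by rewrite comp_lfunE -g'x -f'x -hE comp_lfunE.
Qed.

Lemma retract_projective P Q (i : 'Hom(Q, P)) (p : 'Hom(P, Q)) :
  rprojective P -> is_rhom i -> is_rhom p -> (p \o i)%VF = \1%VF ->
  rprojective Q.
Proof.
move=> prP iH pH piE X Y g f gH fH gF.
have [|h hH hE] := prP X Y g (f \o p)%VF gH _ gF; first exact: is_rhom_comp.
exists (h \o i)%VF; first exact: is_rhom_comp.
by rewrite comp_lfunA hE -comp_lfunA piE comp_lfun1r.
Qed.

End ModuleTheory.

(** * Free modules and projective covers *)

Section Covers.
Variables (k : fieldType) (A : falgType k).
Implicit Types M N X Y P Q : rmodule A.

Section FreeModule.
Variable n : nat.

Definition free_act (x : {ffun 'I_n -> A}) (a : A) : {ffun 'I_n -> A} :=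
  [ffun i => x i * a].

Lemma free_act_is_ract : is_ract free_act.
Proof.
split=> [a c x y|x c a b|x|x a b]; apply/ffunP => i; rewrite !ffunE.
- by rewrite mulrDl scalerAl.
- by rewrite mulrDr scalerAr.
- exact: mulr1.
- by rewrite mulrA.
Qed.

Definition free_mod : rmodule A := RModule free_act_is_ract.

Section FreeMap.
Variables (M : rmodule A) (m : 'I_n -> M).

Definition free_map : 'Hom(free_mod, M) :=
  linfun (fun c : free_mod => \sum_i ract (m i) ((c : {ffun 'I_n -> A}) i)).

Lemma free_mapE (c : {ffun 'I_n -> A}) : free_map c = \sum_i ract (m i) (c i).
Proof.
apply: linfunP => a x y; rewrite scaler_sumr -big_split; apply: eq_bigr => i _.
by rewrite !ffunE; apply: ract_linear_r.
Qed.

Lemma free_map_hom : is_rhom free_map.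
Proof.
by move=> x a; rewrite !free_mapE ract_suml; apply: eq_bigr => i _; rewrite ffunE ractM.
Qed.

End FreeMap.

Lemma free_projective : rprojective free_mod.
Proof.
move=> X Y g f gH fH gF.
pose e i : {ffun 'I_n -> A} := [ffun j => (i == j)%:R].
exists (free_map (fun i => (g^-1)%VF (f (e i)))); first exact: free_map_hom.
apply/lfunP => c; rewrite comp_lfunE free_mapE linear_sum /=.
have cE : c = \sum_i free_act (e i) ((c : {ffun 'I_n -> A}) i) :> {ffun 'I_n -> A}.
  apply/ffunP => j; rewrite sum_ffunE (bigD1 j) //= big1 => [|i /negPf ij].
    by rewrite !ffunE eqxx mul1r addr0.
  by rewrite !ffunE ij mul0r.
rewrite [in RHS]cE linear_sum; apply: eq_bigr => i _.
by rewrite gH limg_lfunVK ?gF ?memvf // -fH.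
Qed.

End FreeModule.

Lemma projective_surjection M :
  exists (P : rmodule A) (f : 'Hom(P, M)),
    [/\ rprojective P, is_rhom f & limg f = fullv].
Proof.
pose b := vbasis {:M}.
exists (free_mod (\dim {:M})), (free_map (fun i => b`_i)).
split; [exact: free_projective | exact: free_map_hom |].
apply/limg_fullP => y; exists [ffun i => coord b i y *: 1].
rewrite free_mapE {1}(coord_vbasis (memvf y)); apply: eq_bigr => i _.
by rewrite ffunE ractZr ract1.
Qed.

(** A surjection from a projective module of least dimension is a projective
    cover.  If a submodule [U] also maps onto [M], then [f] lifts through [U],
    which gives an endomorphism [h] of [P] over [M] with image in [U].  Among
    those take one of least rank: it is bijective on its image, so that image
    is a direct summand of [P] that still maps onto [M], and it must be [P]. *)
Lemma projective_cover M :
  exists (P : rmodule A) (f : 'Hom(P, M)),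
    [/\ rprojective P, is_rhom f, limg f = fullv & superfluous (lker f)].
Proof.
pose q d := `[< exists (P : rmodule A) (f : 'Hom(P, M)),
  [/\ rprojective P, is_rhom f, limg f = fullv & \dim {:P} = d] >].
have exq : exists d, q d.
  have [P [f [prP fH fF]]] := projective_surjection M.
  by exists (\dim {:P}); apply/asboolP; exists P, f.
case: (ex_minnP exq) => d /asboolP[P [f [prP fH fF dP]]] mind.
exists P, f; split=> // U sU KU.
have fU : limg (f \o subincl sU) = fullv.
  apply/limg_fullP => y; have /limg_fullP/(_ y)[x ->] := fF.
  have : x \in (lker f + U)%VS by rewrite KU memvf.
  move=> /memv_addP[u]; rewrite memv_ker => /eqP fu [v vU ->].
  exists (vsproj U v); rewrite linearD /= fu add0r.
  by rewrite comp_lfunE subincl_proj.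
pose r n := `[< exists h : 'Hom(P, P),
  [/\ is_rhom h, (f \o h)%VF = f, (limg h <= U)%VS & \dim (limg h) = n] >].
have exr : exists n, r n.
  have [|h hH hE] := prP _ _ _ f _ fH fU.
    exact: is_rhom_comp fH (@subincl_hom _ _ _ _ sU).
  exists (\dim (limg (subincl sU \o h))); apply/asboolP.
  exists (subincl sU \o h)%VF; split=> //.
  - exact: is_rhom_comp (@subincl_hom _ _ _ _ sU) hH.
  - by rewrite comp_lfunA.
  - by rewrite limg_comp -[X in (_ <= X)%VS](limg_subincl sU) limgS ?subvf.
case: (ex_minnP exr) => n /asboolP[h [hH hE hU hn]] minn.
have hhI : (h @: limg h)%VS = limg h.
  apply/eqP; rewrite eqEdim limgS ?subvf //= hn minn //; apply/asboolP.
  exists (h \o h)%VF; split; rewrite ?limg_comp //.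
  - exact: is_rhom_comp.
  - by rewrite comp_lfunA hE.
  - by rewrite (subv_trans _ hU) // limgS ?subvf.
have sW := limg_submodule hH.
have [p pH pE] := corestrict sW hH (subvv _).
set i := subincl sW in pE.
have px x : i (p x) = h x by move/lfunP: pE => <-; rewrite comp_lfunE.
have piF : limg (p \o i) = fullv.
  apply/limg_fullP => y.
  have : i y \in (h @: limg h)%VS by rewrite hhI subinclE subvsP.
  move=> /memv_imgP[x xW yE]; exists (vsproj (limg h) x).
  by apply: (@subincl_inj _ _ _ _ sW); rewrite comp_lfunE px subincl_proj.
have pi0 := endo_surj_lker0 piF.
have piH := is_rhom_comp pH (@subincl_hom _ _ _ _ sW).
have sH := is_rhom_inv piH pi0 piF.
have prW : rprojective (submod sW).
  apply: (@retract_projective _ _ _ _ (i \o (p \o i)^-1)%VF p prP _ pH).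
    exact: is_rhom_comp (@subincl_hom _ _ _ _ sW) sH.
  by rewrite comp_lfunA lker0_compfV // pi0.
have : (\dim {:P} <= \dim {:submod sW})%N.
  rewrite dP mind //; apply/asboolP; exists (submod sW), (f \o i)%VF.
  split=> //; first exact: is_rhom_comp fH (@subincl_hom _ _ _ _ sW).
  apply/limg_fullP => y; have /limg_fullP/(_ y)[x ->] := fF.
  by exists (p x); rewrite comp_lfunE px -comp_lfunE hE.
rewrite (dimvf (submod sW)) => leW.
apply/eqP; rewrite eqEdim subvf (leq_trans leW) //.
exact: dimvS.
Qed.

End Covers.

(** * Minimal resolutions *)

Section Resolutions.
Variables (k : fieldType) (A : falgType k).
Implicit Types M N X Y P Q : rmodule A.

Definition cover M : rmodule A := sval (cid (projective_cover M)).

Definition cover_map M : 'Hom(cover M, M) :=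
  sval (cid (svalP (cid (projective_cover M)))).

Lemma cover_mapP M : [/\ rprojective (cover M), is_rhom (cover_map M),
  limg (cover_map M) = fullv & superfluous (lker (cover_map M))].
Proof. exact: (svalP (cid (svalP (cid (projective_cover M))))). Qed.

Lemma cover_map_hom M : is_rhom (cover_map M).
Proof. by case: (cover_mapP M). Qed.

Arguments cover_map_hom : clear implicits.

Definition cover_incl M := subincl (lker_submodule (cover_map_hom M)).

Fixpoint syzygy M n : rmodule A :=
  if n is n'.+1 then submod (lker_submodule (cover_map_hom (syzygy M n')))
  else M.

Definition syzygy_diff M n :
    'Hom(cover (syzygy M n.+1), cover (syzygy M n)) :=
  (cover_incl (syzygy M n) \o cover_map (syzygy M n.+1))%VF.

Lemma syzygy_diff_hom M n : is_rhom (syzygy_diff M n).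
Proof. exact: is_rhom_comp (@subincl_hom _ _ _ _ _) (cover_map_hom _). Qed.

Arguments syzygy_diff_hom : clear implicits.

Lemma limg_syzygy_diff M n :
  limg (syzygy_diff M n) = lker (cover_map (syzygy M n)).
Proof.
rewrite limg_comp; have [_ _ -> _] := cover_mapP (syzygy M n.+1).
exact: limg_subincl.
Qed.

Lemma lker_syzygy_diff M n :
  lker (syzygy_diff M n) = lker (cover_map (syzygy M n.+1)).
Proof.
apply/vspaceP => x; rewrite !memv_ker comp_lfunE.
rewrite -[X in _ == X](linear0 (cover_incl (syzygy M n))).
exact: (inj_eq (@subincl_inj _ _ _ _ _)).
Qed.

Lemma limg_syzygy_diffS M n :
  limg (syzygy_diff M n.+1) = lker (syzygy_diff M n).
Proof. by rewrite limg_syzygy_diff lker_syzygy_diff. Qed.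

Lemma cover_projective M : rprojective (cover M).
Proof. by case: (cover_mapP M). Qed.

Arguments cover_projective : clear implicits.

Lemma cover_map_surj M : limg (cover_map M) = fullv.
Proof. by case: (cover_mapP M). Qed.

Definition cover_resolution M : projective_resolution M :=
  ProjectiveResolution (fun n => cover_projective (syzygy M n))
    (syzygy_diff_hom M) (cover_map_hom M) (cover_map_surj M)
    (limg_syzygy_diff M 0) (limg_syzygy_diffS M).

Lemma cover_resolution_minimal M : minimal_resolution (cover_resolution M).
Proof.
split=> [|n]; first by case: (cover_mapP M).
by rewrite /= lker_syzygy_diff; case: (cover_mapP (syzygy M n.+1)).
Qed.

(** The inductive step of the comparison: if [X] is a retract of [Y] up to an
    automorphism, then so are the modules that cover parts of them.  Both lifts
    come from projectivity.  Their composite [p' \o i'] covers an automorphism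
    of the image of [d], so its image and [lker d] together span [P]; as
    [lker d] is superfluous, it is onto. *)
Lemma retract_step X Y P Q (d : 'Hom(P, X)) (e : 'Hom(Q, Y))
    (i : 'Hom(X, Y)) (p : 'Hom(Y, X)) :
  rprojective P -> rprojective Q -> is_rhom d -> is_rhom e -> is_rhom i ->
  is_rhom p -> superfluous (lker d) -> lker (p \o i) = 0%VS ->
  (i @: limg d <= limg e)%VS -> (p @: limg e <= limg d)%VS ->
  exists (i' : 'Hom(P, Q)) (p' : 'Hom(Q, P)),
    [/\ is_rhom i', is_rhom p', lker (p' \o i') = 0%VS,
        (i' @: lker d <= lker e)%VS & (p' @: lker e <= lker d)%VS].
Proof.
move=> prP prQ dH eH iH pH sd pi0 id pe.
have [||i' i'H i'E] := rprojective_lift (g := e) (f := (i \o d)%VF) prP eH.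
- exact: is_rhom_comp.
- by rewrite limg_comp.
have [||p' p'H p'E] := rprojective_lift (g := d) (f := (p \o e)%VF) prQ dH.
- exact: is_rhom_comp.
- by rewrite limg_comp.
have ei x : e (i' x) = i (d x) by move/lfunP: i'E => /(_ x); rewrite !comp_lfunE.
have dp x : d (p' x) = p (e x) by move/lfunP: p'E => /(_ x); rewrite !comp_lfunE.
exists i', p'; split=> //; last 2 first.
- apply/subvP => _ /memv_imgP[x + ->].
  by rewrite !memv_ker ei => /eqP->; rewrite linear0.
- apply/subvP => _ /memv_imgP[x + ->].
  by rewrite !memv_ker dp => /eqP->; rewrite linear0.
apply/endo_surj_lker0/sd; first exact/limg_submodule/is_rhom_comp.
have piD : ((p \o i) @: limg d)%VS = limg d.
  apply/eqP; rewrite eqEdim (limg_dim_eq (f := (p \o i)%VF)) ?pi0 ?capv0 //.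
  by rewrite leqnn andbT limg_comp (subv_trans (limgS _ id)).
apply/vspaceP => x; rewrite memvf.
have : d x \in ((p \o i) @: limg d)%VS by rewrite piD memv_img ?memvf.
move=> /memv_imgP[_ /limgP[y ->] dx].
rewrite -[x](subrK (p' (i' y))) memv_add //.
  by rewrite memv_ker linearB /= dp ei dx comp_lfunE subrr.
by apply/limgP; exists y; rewrite comp_lfunE.
Qed.

(** A minimal resolution is termwise a retract, up to automorphisms, of every
    projective resolution of every module of which the resolved module is a
    retract; hence it has the smallest terms. *)
Lemma minimal_resolution_dim M N (i : 'Hom(M, N)) (p : 'Hom(N, M))
    (P : projective_resolution M) (Q : projective_resolution N) :
  is_rhom i -> is_rhom p -> (p \o i)%VF = \1%VF -> minimal_resolution P ->
  forall n, (\dim {:P n} <= \dim {:Q n})%N.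
Proof.
move=> iH pH pi1 [sa sd] n.
suff [i' [p' [_ _ pi0 _ _]]] : exists (i' : 'Hom(P n, Q n)) (p' : 'Hom(Q n, P n)),
    [/\ is_rhom i', is_rhom p', lker (p' \o i') = 0%VS,
        (i' @: limg (res_diff P n) <= limg (res_diff Q n))%VS
      & (p' @: limg (res_diff Q n) <= limg (res_diff P n))%VS].
  rewrite -(limg_dim_eq (f := i')) ?dimvS ?subvf //.
  apply/eqP; rewrite -subv0 -pi0; apply/subvP => x /memv_capP[_].
  by rewrite !memv_ker comp_lfunE => /eqP->; rewrite linear0.
elim: n => [|n [i' [p' [i'H p'H pi0 id pd]]]].
  rewrite !res_exact0; apply: (retract_step (i := i) (p := p)) => //;
    try exact: res_projective; try exact: res_aug_hom.
  - by apply/eqP/lker0P => x y; rewrite pi1 !id_lfunE.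
  - by rewrite !res_aug_surj subvf.
  - by rewrite !res_aug_surj subvf.
rewrite !res_exactS; apply: (retract_step (i := i') (p := p')) => //;
  try exact: res_projective; exact: res_diff_hom.
Qed.

End Resolutions.

(** * Tensor products with bimodules that are projective on the left *)

Section BimoduleTheory.
Variables (k : fieldType) (A B : falgType k) (M : bimodule A B).
Implicit Types x y : M.

Lemma blact_linear a : linear (fun x : M => blact a x).
Proof. by case: (blactP M) => + _ _ _; apply. Qed.

Lemma blact_linear_l x : linear (fun a => blact a x).
Proof. by case: (blactP M) => _ + _ _; apply. Qed.

Lemma blact1 x : blact 1 x = x.
Proof. by case: (blactP M). Qed.

Lemma blactM a b x : blact (a * b) x = blact a (blact b x).
Proof. by case: (blactP M). Qed.

Lemma bract_linear b : linear (fun x : M => bract x b).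
Proof. by case: (bractP M) => + _ _ _; apply. Qed.

Lemma bract_linear_r x : linear (bract x).
Proof. by case: (bractP M) => _ + _ _; apply. Qed.

Lemma bract1 x : bract x 1 = x.
Proof. by case: (bractP M). Qed.

Lemma bractM x a b : bract x (a * b) = bract (bract x a) b.
Proof. by case: (bractP M). Qed.

Lemma blactD a : {morph (fun x : M => blact a x) : x y / x + y}.
Proof. by move=> x y; have := blact_linear a 1 x y; rewrite !scale1r. Qed.

Lemma blact0 a : blact a (0 : M) = 0.
Proof. by apply: (addrI (blact a (0 : M))); rewrite -blactD !addr0. Qed.

Lemma blact0l x : blact 0 x = 0.
Proof.
by have := blact_linear_l x (-1) 0 0; rewrite scaler0 addr0 scaleN1r addNr.
Qed.

Lemma blactZl x c a : blact (c *: a) x = c *: blact a x.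
Proof. by have := blact_linear_l x c a 0; rewrite blact0l !addr0. Qed.

Lemma blact_sum a I r (p : pred I) (F : I -> M) :
  blact a (\sum_(i <- r | p i) F i) = \sum_(i <- r | p i) blact a (F i).
Proof. exact: (big_morph _ (blactD a) (blact0 a)). Qed.

Lemma bractD b : {morph (fun x : M => bract x b) : x y / x + y}.
Proof. exact: (@ractD _ _ (right_restr M)). Qed.

Lemma bract0 b : bract (0 : M) b = 0.
Proof. exact: (@ract0 _ _ (right_restr M)). Qed.

Lemma bractZr x c b : bract x (c *: b) = c *: bract x b.
Proof. exact: (@ractZr _ _ (right_restr M)). Qed.

(** By the dual basis lemma, this is what projectivity of [M] as a left module
    amounts to. *)
Record left_dual_basis := LeftDualBasis {
  ldb_size : nat;
  ldb_vec : 'I_ldb_size -> M;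
  ldb_coord : 'I_ldb_size -> 'Hom(M, A);
  ldb_coordM : forall i a x, ldb_coord i (blact a x) = a * ldb_coord i x;
  ldb_sum : forall x, \sum_i blact (ldb_coord i x) (ldb_vec i) = x }.

Lemma lfree_is_lact n : is_lact (fun (a : A) (x : {ffun 'I_n -> A}) =>
  [ffun i => a * x i] : {ffun 'I_n -> A}).
Proof.
split=> [a c x y|x c a b|x|a b x]; apply/ffunP => i; rewrite !ffunE.
- by rewrite mulrDr scalerAr.
- by rewrite mulrDl scalerAl.
- exact: mul1r.
- by rewrite mulrA.
Qed.

(** A splitting of a surjection from a free module onto [M] is a dual basis. *)
Lemma left_dual_basis_of_projective :
  lprojective (left_restr M) -> inhabited left_dual_basis.
Proof.
move=> prM; pose n := \dim {:M}; pose b := vbasis {:M}.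
pose F := LModule (lfree_is_lact n).
pose g0 (c : F) : left_restr M := \sum_i blact ((c : {ffun 'I_n -> A}) i) b`_i.
have g0l : linear g0.
  move=> a x y; rewrite scaler_sumr -big_split; apply: eq_bigr => i _.
  by rewrite !ffunE; apply: blact_linear_l.
pose g : 'Hom(F, left_restr M) := linfun g0.
have gE c : g c = g0 c by apply: linfunP.
have gH : is_lhom g.
  move=> a x; rewrite !gE [RHS]blact_sum; apply: eq_bigr => i _.
  by rewrite ffunE blactM.
have gF : limg g = fullv.
  apply/limg_fullP => y; exists [ffun i => coord b i y *: 1].
  rewrite gE {1}(coord_vbasis (memvf y)); apply: eq_bigr => i _.
  by rewrite ffunE blactZl blact1.
have [|h hH hE] := prM _ _ g \1%VF gH _ gF; first by move=> a x; rewrite !id_lfunE.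
pose co i (x : M) := (h x : {ffun 'I_n -> A}) i.
have col i : linear (co i) by move=> c x y; rewrite /co linearP !ffunE.
have coE i x : linfun (co i) x = co i x by apply: linfunP.
constructor; apply: (@LeftDualBasis n (fun i => b`_i) (fun i => linfun (co i))).
  by move=> i a x; rewrite !coE /co [h _]hH ffunE.
move=> x; under eq_bigr do rewrite coE.
by move/lfunP: hE => /(_ x); rewrite comp_lfunE id_lfunE gE.
Qed.

End BimoduleTheory.

Arguments ldb_vec {k A B M} l i.
Arguments ldb_coord {k A B M} l i.
Arguments ldb_coordM {k A B M} l i a x.
Arguments ldb_sum {k A B M} l x.

(** Given a left dual basis [m_i], [phi_i] of [M], the map
    [u (x) x |-> (u phi_i(x))_i] identifies [U (x)_A M] with the image of an
    idempotent endomorphism of the direct sum of copies of [U], and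
    [z |-> \sum_i z_i (x) m_i] is its inverse.  In this model the universal
    property is an explicit formula and exactness is read off coordinates. *)
Section Tensor.
Variables (k : fieldType) (A B : falgType k) (M : bimodule A B).
Variable D : left_dual_basis M.
Implicit Types U V W P : rmodule A.

Local Notation vec := (ldb_vec D).
Local Notation co := (ldb_coord D).
Local Notation I := 'I_(ldb_size D).

Definition balanced_bilinear U (V : vectType k) (f : U -> M -> V) : Prop :=
  [/\ forall x, linear (f^~ x), forall u, linear (f u)
    & forall u a x, f (ract u a) x = f u (blact a x)].

Section Construction.
Variable U : rmodule A.

Definition pure_coord (u : U) (x : M) : {ffun I -> U} :=
  [ffun j => ract u (co j x)].

Definition coord_lift (V : vectType k) (f : U -> M -> V) (z : {ffun I -> U}) : V :=
  \sum_i f (z i) (vec i).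

Lemma coord_lift_linear (V : vectType k) (f : U -> M -> V) :
  balanced_bilinear f -> linear (coord_lift f).
Proof.
move=> [fl _ _] c x y; rewrite scaler_sumr -big_split; apply: eq_bigr => i _.
by rewrite !ffunE; apply: fl.
Qed.

Lemma coord_lift_pure (V : vectType k) (f : U -> M -> V) u x :
  balanced_bilinear f -> coord_lift f (pure_coord u x) = f u x.
Proof.
move=> [fl fr fb]; rewrite -[in RHS](ldb_sum D x).
have fL := linfunP (fr u); rewrite -fL linear_sum; apply: eq_bigr => i _.
by rewrite /= fL ffunE fb.
Qed.

Lemma pure_coord_balanced : balanced_bilinear pure_coord.
Proof.
split=> [x c u v|u c x y|u a x]; apply/ffunP => i; rewrite !ffunE.
- exact: ract_linear.
- by rewrite linearP; apply: ract_linear_r.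
- by rewrite ldb_coordM ractM.
Qed.

Definition tensor_space : {vspace {ffun I -> U}} :=
  limg (linfun (coord_lift pure_coord)).

Lemma pure_coord_mem u x : pure_coord u x \in tensor_space.
Proof.
apply/limgP; exists (pure_coord u x); rewrite linfunP.
  by rewrite coord_lift_pure //; apply: pure_coord_balanced.
exact/coord_lift_linear/pure_coord_balanced.
Qed.

Lemma tensor_spaceP z : z \in tensor_space -> coord_lift pure_coord z = z.
Proof.
have lL := linfunP (coord_lift_linear pure_coord_balanced).
move=> /limgP[y ->]; rewrite lL -[LHS]lL [X in linfun _ X]/coord_lift.
rewrite linear_sum; apply: eq_bigr => i _.
by rewrite /= lL coord_lift_pure //; apply: pure_coord_balanced.
Qed.

(** The constructions with a final [0] live on the bare vector space: the
    action of [B] on it is itself defined by the universal property. *)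
Definition tpure0 (u : U) (x : M) : subvs_of tensor_space :=
  vsproj tensor_space (pure_coord u x).

Lemma tpure0_balanced : balanced_bilinear tpure0.
Proof.
have [p1 p2 p3] := pure_coord_balanced.
split=> [x c u v|u c x y|u a x]; rewrite /tpure0.
- by rewrite /= p1 linearP.
- by rewrite p2 linearP.
- by rewrite p3.
Qed.

Definition tlift0 (V : vectType k) (f : U -> M -> V) :
    'Hom(subvs_of tensor_space, V) :=
  linfun (fun z : subvs_of tensor_space => coord_lift f (vsval z)).

Lemma tlift0E (V : vectType k) (f : U -> M -> V) z :
  balanced_bilinear f -> tlift0 f z = coord_lift f (vsval z).
Proof.
move=> fB; apply: (linfunP (f := fun z => coord_lift f (vsval z))) => c x y.
by rewrite linearP /=; apply: coord_lift_linear.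
Qed.

Lemma tlift0_pure (V : vectType k) (f : U -> M -> V) u x :
  balanced_bilinear f -> tlift0 f (tpure0 u x) = f u x.
Proof.
by move=> fB; rewrite tlift0E // vsprojK ?pure_coord_mem ?coord_lift_pure.
Qed.

Lemma tens_sum0 (z : subvs_of tensor_space) :
  z = \sum_i tpure0 (vsval z i) (vec i).
Proof.
apply: subvs_inj; rewrite -[LHS](tensor_spaceP (subvsP z)) linear_sum.
by apply: eq_bigr => i _; rewrite /= vsprojK ?pure_coord_mem.
Qed.

Lemma tens_ext0 (V : vectType k) (f g : 'Hom(subvs_of tensor_space, V)) :
  (forall u x, f (tpure0 u x) = g (tpure0 u x)) -> f = g.
Proof.
move=> fg; apply/lfunP => z; rewrite [z]tens_sum0 !linear_sum.
by apply: eq_bigr => i _; apply: fg.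
Qed.

Lemma tact_balanced b : balanced_bilinear (fun u x => tpure0 u (bract x b)).
Proof.
have [p1 p2 p3] := tpure0_balanced.
split=> [x|u c x y|u a x]; first exact: p1.
- by rewrite bract_linear p2.
- by rewrite p3 blractA.
Qed.

Definition tact (z : subvs_of tensor_space) (b : B) : subvs_of tensor_space :=
  tlift0 (fun u x => tpure0 u (bract x b)) z.

Lemma tact_is_ract : is_ract tact.
Proof.
have [p1 p2 p3] := tpure0_balanced.
split=> [b c x y|z c a b|z|z a b].
- by rewrite /tact linearP.
- rewrite /tact !tlift0E; try exact: tact_balanced.
  rewrite scaler_sumr -big_split; apply: eq_bigr => i _.
  by rewrite bract_linear_r p2.
- suff -> : tact z 1 = \1%VF z by rewrite id_lfunE.
  congr (fun_of_lfun _ z); apply: tens_ext0 => u x.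
  by rewrite id_lfunE tlift0_pure ?bract1 //; apply: tact_balanced.
- rewrite {2}/tact -comp_lfunE; congr (fun_of_lfun _ z).
  apply: tens_ext0 => u x; rewrite comp_lfunE.
  by rewrite !tlift0_pure ?bractM //; apply: tact_balanced.
Qed.

Definition tensor : rmodule B := RModule tact_is_ract.

Definition tpure (u : U) (x : M) : tensor := tpure0 u x.

Lemma tpure_balanced : balanced_bilinear tpure.
Proof. exact: tpure0_balanced. Qed.

Lemma tpure_act u x b : ract (tpure u x) b = tpure u (bract x b).
Proof. by rewrite [LHS]tlift0_pure //; apply: tact_balanced. Qed.

Lemma tensor_ext (V : vectType k) (f g : 'Hom(tensor, V)) :
  (forall u x, f (tpure u x) = g (tpure u x)) -> f = g.
Proof. exact: tens_ext0. Qed.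

Definition tlift (V : vectType k) (f : U -> M -> V) : 'Hom(tensor, V) := tlift0 f.

Lemma tlift_pure (V : vectType k) (f : U -> M -> V) u x :
  balanced_bilinear f -> tlift f (tpure u x) = f u x.
Proof. exact: tlift0_pure. Qed.

Lemma tlift_hom (Y : rmodule B) (f : U -> M -> Y) :
  balanced_bilinear f -> (forall u x b, f u (bract x b) = ract (f u x) b) ->
  is_rhom (tlift f).
Proof.
move=> fB fr z b.
have zL := linfunP (@ract_linear _ _ tensor b).
have yL := linfunP (@ract_linear _ _ Y b).
suff /lfunP/(_ z) : (tlift f \o linfun (fun z : tensor => ract z b))%VF
    = (linfun (fun y : Y => ract y b) \o tlift f)%VF.
  by rewrite !comp_lfunE zL yL.
apply: tensor_ext => u x.
by rewrite !comp_lfunE zL yL tpure_act !tlift_pure.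
Qed.

Definition tcoord (i : I) : 'Hom(tensor, U) := tlift (fun u x => ract u (co i x)).

Lemma tcoord_pure i u x : tcoord i (tpure u x) = ract u (co i x).
Proof.
rewrite tlift_pure //; split=> [y|v c y z|v a y]; first exact: ract_linear.
- by rewrite linearP; apply: ract_linear_r.
- by rewrite ldb_coordM ractM.
Qed.

Lemma tensor_sum (z : tensor) : z = \sum_i tpure (tcoord i z) (vec i).
Proof.
have [p1 _ _] := tpure_balanced.
pose s := \sum_i (linfun (tpure^~ (vec i)) \o tcoord i)%VF : 'Hom(tensor, tensor).
have sE z' : s z' = \sum_i tpure (tcoord i z') (vec i).
  by rewrite sum_lfunE; apply: eq_bigr => i _; rewrite comp_lfunE linfunP.
rewrite -sE -[LHS](id_lfunE z); congr (fun_of_lfun _ z).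
apply: tensor_ext => u x; rewrite id_lfunE sE.
have [_ p2 p3] := tpure_balanced; have pL := linfunP (p2 u).
rewrite -[in LHS](ldb_sum D x) -pL linear_sum; apply: eq_bigr => i _.
by rewrite /= pL tcoord_pure p3.
Qed.

Lemma tensor_dim : (\dim {:tensor} <= ldb_size D * \dim {:U})%N.
Proof.
rewrite dimvf [X in (X <= _)%N]/(\dim tensor_space).
apply: leq_trans (dimvS (subvf _)) _.
by rewrite !dimvf -[X in (_ <= X * _)%N]card_ord; apply: leqnn.
Qed.

End Construction.

Arguments tcoord {U} i.

Section Functor.
Variables (U V : rmodule A) (f : 'Hom(U, V)) (fH : is_rhom f).

Definition tmap : 'Hom(tensor U, tensor V) := tlift (fun u x => tpure (f u) x).

Lemma tmap_balanced : balanced_bilinear (fun u x => tpure (f u) x : tensor V).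
Proof.
have [p1 p2 p3] := tpure_balanced V.
split=> [x c u v|u|u a x]; last by rewrite fH p3.
- by rewrite linearP p1.
- exact: p2.
Qed.

Lemma tmap_pure u x : tmap (tpure u x) = tpure (f u) x.
Proof. by rewrite tlift_pure //; apply: tmap_balanced. Qed.

Lemma tmap_hom : is_rhom tmap.
Proof. by apply: tlift_hom tmap_balanced _ => u x b; rewrite tpure_act. Qed.

Lemma tcoord_tmap i z : tcoord i (tmap z) = f (tcoord i z).
Proof.
rewrite -!comp_lfunE; congr (fun_of_lfun _ z); apply: tensor_ext => u x.
by rewrite !comp_lfunE tmap_pure !tcoord_pure fH.
Qed.

Lemma limg_tmap z :
  (forall i, tcoord i z \in limg f) -> z \in limg tmap.
Proof.
move=> zf; apply/limgP; exists (\sum_i tpure ((f^-1)%VF (tcoord i z)) (vec i)).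
rewrite linear_sum [LHS]tensor_sum; apply: eq_bigr => i _.
by rewrite /= tmap_pure limg_lfunVK.
Qed.

Lemma tmap_surj : limg f = fullv -> limg tmap = fullv.
Proof.
move=> fF; apply/vspaceP => z; rewrite memvf; apply: limg_tmap => i.
by rewrite fF memvf.
Qed.

End Functor.

Lemma tmap_exact U V W (f : 'Hom(U, V)) (g : 'Hom(V, W)) :
  is_rhom f -> is_rhom g -> limg f = lker g -> limg (tmap f) = lker (tmap g).
Proof.
move=> fH gH fg; apply/vspaceP => z; apply/idP/idP => [/limgP[y ->]|].
  have gf v : g (f v) = 0.
    by apply/eqP; rewrite -memv_ker -fg; apply/limgP; exists v.
  rewrite memv_ker [tmap g _]tensor_sum big1 // => i _.
  rewrite !tcoord_tmap // gf; have [p1 _ _] := tpure_balanced W.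
  by rewrite -(linfunP (p1 (vec i))) linear0.
rewrite memv_ker => /eqP gz; apply: limg_tmap => // i.
by rewrite fg memv_ker -tcoord_tmap // gz linear0.
Qed.

Section Hom.
Variable Y : rmodule B.

(** The module of all [k]-linear maps; [Hom_B(M, Y)] is a submodule of it. *)
Definition hom_act (h : 'Hom(M, Y)) (a : A) : 'Hom(M, Y) :=
  linfun (fun x => h (blact a x)).

Lemma hom_actE h a x : hom_act h a x = h (blact a x).
Proof. by apply: linfunP => c y z; rewrite blact_linear linearP. Qed.

Lemma hom_act_is_ract : is_ract hom_act.
Proof.
split=> [a c g h|h c a b|h|h a b]; apply/lfunP => x;
  rewrite ?add_lfunE ?scale_lfunE !hom_actE ?add_lfunE ?scale_lfunE //.
- by rewrite blact_linear_l linearP.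
- by rewrite blact1.
- by rewrite blactM.
Qed.

Definition hom_mod : rmodule A := RModule hom_act_is_ract.

End Hom.

(** By the adjunction between [- (x)_A M] and [Hom_B(M, -)], and because
    [Hom_B(M, -)] preserves surjections when [M] is projective over [B]. *)
Lemma tensor_projective P :
  rprojective (right_restr M) -> rprojective P -> rprojective (tensor P).
Proof.
move=> prM prP X Y g f gH fH gF.
have [||H HE] := @vspace_of_closed k (hom_mod X)
    (fun h : 'Hom(M, X) => forall x b, h (bract x b) = ract (h x) b).
- by move=> x b; rewrite !zero_lfunE ract0.
- move=> c h h' hH hH' x b.
  by rewrite !add_lfunE !scale_lfunE hH hH' ract_linear.
have sH : is_submodule H.
  move=> h a /HE hH; apply/HE => x b.
  by rewrite !hom_actE blractA hH.
pose gs : 'Hom(hom_mod X, hom_mod Y) := linfun (fun h : 'Hom(M, X) => (g \o h)%VF).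
have gsE h : gs h = (g \o h)%VF.
  by apply: (linfunP (f := fun h : 'Hom(M, X) => (g \o h)%VF)) => c h1 h2;
    rewrite comp_lfunDr comp_lfunZr.
have gsH : is_rhom gs.
  move=> h a; apply/lfunP => x.
  by rewrite !gsE hom_actE !comp_lfunE hom_actE.
have [p1 p2 p3] := tpure_balanced P.
pose fx p : 'Hom(M, Y) := linfun (fun x => f (tpure p x)).
have fxE p x : fx p x = f (tpure p x).
  by apply: linfunP => c y z; rewrite p2 linearP.
pose fs : 'Hom(P, hom_mod Y) := linfun fx.
have fsE p : fs p = fx p.
  apply: linfunP => c u v; apply/lfunP => x.
  by rewrite add_lfunE scale_lfunE !fxE p1 linearP.
have fsH : is_rhom fs.
  move=> p a; apply/lfunP => x.
  by rewrite hom_actE !fsE !fxE p3.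
have [|||h hH hE] := rprojective_lift (g := (gs \o subincl sH)%VF) (f := fs) prP.
- exact: is_rhom_comp gsH (@subincl_hom _ _ _ _ sH).
- exact: fsH.
- apply/subvP => _ /limgP[p ->].
  have [|l lH lE] := prM X Y g (fx p) gH _ gF.
    by move=> x b; rewrite !fxE -tpure_act fH.
  apply/limgP; exists (vsproj H l).
  by rewrite comp_lfunE subincl_proj ?gsE ?lE ?fsE //; apply/HE/lH.
pose hh p : 'Hom(M, X) := subincl sH (h p).
have hhH p x b : hh p (bract x b) = ract (hh p x) b.
  by move: x b; apply/HE; rewrite /hh subinclE; apply: subvsP.
have hhB : balanced_bilinear (fun p x => hh p x).
  split=> [x c u v|u|u a x].
  - by rewrite /hh !linearP /= add_lfunE scale_lfunE.
  - exact: linearP.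
  - by rewrite /hh hH subincl_hom hom_actE.
exists (tlift hh); first exact: tlift_hom.
apply: tensor_ext => p x; rewrite comp_lfunE tlift_pure // -fxE -fsE -hE.
have -> : ((gs \o subincl sH) \o h)%VF p = (g \o hh p)%VF by rewrite !comp_lfunE gsE.
by rewrite comp_lfunE.
Qed.

End Tensor.

(** Tensoring a resolution with [N] keeps it exact because [N] is projective on
    the left, and keeps its terms projective because it is so on the right. *)
Section TensorResolution.
Variables (k : fieldType) (B A : falgType k) (N : bimodule B A).
Variables (D : left_dual_basis N) (prN : rprojective (right_restr N)).

Definition tensor_resolution (W : rmodule B) (P : projective_resolution W) :
    projective_resolution (tensor D W).
Proof.
apply: (@ProjectiveResolution k A (tensor D W) (fun n => tensor D (P n))
  (fun n => tmap D (res_diff P n)) (tmap D (res_aug P))).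
- by move=> n; apply: tensor_projective => //; apply: res_projective.
- by move=> n; apply/tmap_hom/res_diff_hom.
- exact/tmap_hom/res_aug_hom.
- by apply: tmap_surj; [apply: res_aug_hom | apply: res_aug_surj].
- apply: tmap_exact; [exact: res_diff_hom | exact: res_aug_hom |].
  exact: res_exact0.
- move=> n; apply: tmap_exact; [exact: res_diff_hom | exact: res_diff_hom |].
  exact: res_exactS.
Defined.

End TensorResolution.

(** * Separable division *)

Section Separable.
Variables (k : fieldType) (A B : falgType k).

Lemma tensor_eq (M : bimodule A B) (D : left_dual_basis M) (U : rmodule A)
    (V : vectType k) (f g : tensor D U -> V) :
  linear f -> linear g -> (forall u x, f (tpure D u x) = g (tpure D u x)) ->
  f =1 g.
Proof.
move=> fl gl fg z; rewrite -(linfunP fl) -(linfunP gl).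
by congr (fun_of_lfun _ z); apply: tensor_ext => u x; rewrite !linfunP.
Qed.

Section TensorIso.
Variables (M : bimodule A B) (N : bimodule B A) (T : bimodule A A).
Variables (t : M -> N -> T) (tT : is_tensor t).

(** The group [G] being arbitrary, this compares maps that are not known to be
    linear, as is the case of those that the universal property provides. *)
Lemma is_tensor_ext (G : zmodType) (g g' : T -> G) :
  {morph g : x y / x + y} -> {morph g' : x y / x + y} ->
  (forall x y, g (t x y) = g' (t x y)) -> g =1 g'.
Proof.
have [[tDl tDr tb] _ _ tU] := tT.
move=> gD g'D gg'.
have zB (h : T -> G) : {morph h : x y / x + y} -> zmod_morphism h.
  by move=> hD x y; apply: (addIr (h y)); rewrite -hD !subrK.
pose a : {additive T -> G} := HB.pack g (GRing.isZmodMorphism.Build T G g (zB _ gD)).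
pose a' : {additive T -> G} := HB.pack g' (GRing.isZmodMorphism.Build T G g' (zB _ g'D)).
have [|_ uniq] := tU G (fun x y => g (t x y)).
  by split=> *; rewrite ?tDl ?tDr ?gD ?tb.
exact: (uniq a a').
Qed.

Lemma is_tensor_linear_l y : linear (t^~ y).
Proof.
have [[tDl _ _] ta _ _] := tT => c x x' /=.
have -> : c *: x = blact (c *: 1) x by rewrite blactZl blact1.
by rewrite tDl -ta blactZl blact1.
Qed.

Lemma is_tensor_linear_r x : linear (t x).
Proof.
have [[_ tDr _] _ ta _] := tT => c y y' /=.
have -> : c *: y = bract y (c *: 1) by rewrite bractZr bract1.
by rewrite tDr -ta bractZr bract1.
Qed.

End TensorIso.

(** If [A] is a bimodule direct summand of [M (x)_B N], then [1] corresponds to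
    an element [e] that commutes with [A], and the projection is a bimodule map
    [pi] with [pi e = 1].  Then [u |-> u (x) e] is [A]-linear since [e] is
    central, and [u (x) z |-> u pi(z)] is a retraction of it. *)
Lemma separable_retract (M : bimodule A B) (N : bimodule B A)
    (X : bimodule A A) (DM : left_dual_basis M) (DN : left_dual_basis N)
    (U : rmodule A) :
  tensor_iso M N (bidirsum (regular_bimodule A) X) ->
  exists (i : 'Hom(U, tensor DN (tensor DM U)))
         (p : 'Hom(tensor DN (tensor DM U), U)),
    [/\ is_rhom i, is_rhom p & (p \o i)%VF = \1%VF].
Proof.
move=> [T [t [tT [F [Fl Fr] [F' F'K FK]]]]].
have [[tDl tDr tb] tl tr tU] := tT.
have tLl := is_tensor_linear_l tT; have tLr := is_tensor_linear_r tT.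
pose pi z : A := (F z).1.
have pi_lin : linear pi by move=> c x y; rewrite /pi linearP.
have pil a z : pi (blact a z) = a * pi z by rewrite /pi Fl.
have pir a z : pi (bract z a) = pi z * a by rewrite /pi Fr.
pose e : T := F' (1, 0).
have pie : pi e = 1 by rewrite /pi /e FK.
have eC a : blact a e = bract e a.
  apply: (can_inj F'K); rewrite Fl Fr /e FK.
  congr pair; first by rewrite /= mulr1 mul1r.
  by rewrite /= blact0 bract0.
(* the retraction [(u (x) x) (x) y |-> u pi(x (x) y)], one factor at a time *)
pose f y (u : U) (x : M) : U := ract u (pi (t x y)).
have fB y : balanced_bilinear (f y).
  split=> [x|u c x x'|u a x]; first exact: ract_linear.
  - by rewrite /f tLl pi_lin ract_linear_r.
  - by rewrite /f -tl pil ractM.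
pose q w y := tlift DM (f y) w.
have q_lin y : linear (fun w => q w y) by move=> c w w'; rewrite /q linearP.
have qE u x y : q (tpure DM u x) y = ract u (pi (t x y)).
  by rewrite /q tlift_pure.
have qB : balanced_bilinear q.
  split=> [//|w c y y'|w b y].
  - apply: (tensor_eq (f := fun w => q w (c *: y + y'))
        (g := fun w => c *: q w y + q w y')) w => //.
      move=> d w w'; rewrite !q_lin scalerDr !scalerDr !scalerA mulrC.
      by rewrite addrACA.
    by move=> u x; rewrite !qE tLr pi_lin ract_linear_r.
  - apply: (tensor_eq (f := fun w => q (ract w b) y)
        (g := fun w => q w (blact b y))) w => //.
      by move=> d w w'; rewrite ract_linear q_lin.
    by move=> u x; rewrite tpure_act !qE tb.
have qr w y a : q w (bract y a) = ract (q w y) a.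
  apply: (tensor_eq (f := fun w => q w (bract y a))
      (g := fun w => ract (q w y) a)) w => //.
    by move=> d w w'; rewrite q_lin ract_linear.
  by move=> u x; rewrite !qE -tr pir ractM.
pose p := tlift DN q.
have pE u x y : p (tpure DN (tpure DM u x) y) = ract u (pi (t x y)).
  by rewrite tlift_pure.
(* [Phi u] is [x (x) y |-> (u (x) x) (x) y], so that [Phi u e] is [u (x) e] *)
have /choice[Phi PhiE] u : exists g : {additive T -> tensor DN (tensor DM U)},
    forall x y, g (t x y) = tpure DN (tpure DM u x) y.
  have [|//] := tU (tensor DN (tensor DM U)) (fun x y => tpure DN (tpure DM u x) y).
  have [N1 N2 N3] := tpure_balanced DN (tensor DM U).
  have [M1 M2 M3] := tpure_balanced DM U.
  split=> [x x' y|x y y'|x b y].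
  - have := M2 u 1 x x'; rewrite !scale1r => ->.
    by have := N1 y 1 (tpure DM u x) (tpure DM u x'); rewrite !scale1r.
  - by have := N2 (tpure DM u x) 1 y y'; rewrite !scale1r.
  - by rewrite -N3 tpure_act.
have PhiD u u' z : Phi (u + u') z = Phi u z + Phi u' z.
  apply: (is_tensor_ext tT (g := Phi (u + u')) (g' := fun z => Phi u z + Phi u' z)).
  - exact: raddfD.
  - by move=> x y; rewrite !raddfD addrACA.
  move=> x y; rewrite !PhiE.
  have [N1 _ _] := tpure_balanced DN (tensor DM U).
  have [M1 _ _] := tpure_balanced DM U.
  have := M1 x 1 u u'; rewrite !scale1r => ->.
  by have := N1 y 1 (tpure DM u x) (tpure DM u' x); rewrite !scale1r.
have Phil u a z : Phi (ract u a) z = Phi u (blact a z).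
  apply: (is_tensor_ext tT (g := Phi (ract u a)) (g' := fun z => Phi u (blact a z))).
  - exact: raddfD.
  - by move=> x y; rewrite blactD raddfD.
  move=> x y; rewrite tl !PhiE.
  by have [_ _ ->] := tpure_balanced DM U.
have Phir u a z : Phi u (bract z a) = ract (Phi u z) a.
  apply: (is_tensor_ext tT (g := fun z => Phi u (bract z a))
    (g' := fun z => ract (Phi u z) a)).
  - by move=> x y; rewrite bractD raddfD.
  - by move=> x y; rewrite raddfD ractD.
  by move=> x y; rewrite tr !PhiE tpure_act.
have ie u a : Phi (ract u a) e = ract (Phi u e) a by rewrite Phil eC Phir.
have i_lin : linear (fun u => Phi u e).
  move=> c u v; rewrite PhiD; congr (_ + _).
  by rewrite -[c *: u](congr1 _ (ract1 u)) -ractZr ie ractZr ract1.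
have iE := linfunP i_lin.
exists (linfun (fun u => Phi u e)), p; split.
- by move=> u a; rewrite !iE ie.
- exact: tlift_hom.
- apply/lfunP => u; rewrite comp_lfunE iE id_lfunE -[RHS]ract1 -pie.
  apply: (is_tensor_ext tT (g := fun z => p (Phi u z)) (g' := fun z => ract u (pi z))).
  + by move=> x y; rewrite raddfD linearD.
  + move=> x y; have := pi_lin 1 x y; rewrite !scale1r => ->.
    exact: ractDr.
  by move=> x y; rewrite PhiE pE.
Qed.

End Separable.

(** * Complexity *)

Lemma least_or_oo_le (p : nat -> Prop) d :
  (least_or_oo p <= d%:Z%:E)%E <-> exists2 d', (d' <= d)%N & p d'.
Proof.
rewrite /least_or_oo; case: pselect => [ex|nex].
  case: ex_minnP => n /asboolP pn minn; rewrite lee_fin lez_nat.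
  split=> [le|[d' le pd']]; first by exists n.
  by apply: leq_trans le; apply: minn; apply/asboolP.
split=> [//|[d' _ pd']]; case: nex; exists d'; exact/asboolP.
Qed.

Lemma least_or_ooP (p : nat -> Prop) :
  (exists d : nat, least_or_oo p = d%:Z%:E) \/ least_or_oo p = +oo%E.
Proof.
by rewrite /least_or_oo; case: pselect => [ex|_]; [left; exists (ex_minn ex) | right].
Qed.

Lemma cx_resolution_le (k : fieldType) (A B : falgType k) (M : rmodule A)
    (N : rmodule B) (P : projective_resolution M) (Q : projective_resolution N)
    (c d : nat) :
  (forall n, \dim {:P n} <= c * \dim {:Q n})%N ->
  (cx_resolution Q <= d%:Z%:E)%E -> (cx_resolution P <= d%:Z%:E)%E.
Proof.
move=> PQ /least_or_oo_le[d' le [l lQ]]; apply/least_or_oo_le; exists d' => //.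
exists (c * l)%N => n n0; apply: le_trans (_ : (c * \dim {:Q n})%N%:R <= _).
  by rewrite ler_nat.
by rewrite !natrM -mulrA ler_wpM2l ?ler0n ?lQ.
Qed.

(** [cx_module] only counts resolutions whose complexity is a natural number;
    a finite upper bound guarantees that it is one. *)
Lemma cx_module_le (k : fieldType) (A : falgType k) (M : rmodule A) (d : nat) :
  (cx_module M <= d%:Z%:E)%E <->
  exists2 P : projective_resolution M,
    minimal_resolution P & (cx_resolution P <= d%:Z%:E)%E.
Proof.
split=> [/least_or_oo_le[d' le [P mP cP]]|[P mP cP]].
  by exists P => //; rewrite cP lee_fin lez_nat.
apply/least_or_oo_le; case: (least_or_ooP (fun d => exists lambda : nat,
    forall n : nat, (1 <= n)%N ->
    (\dim {:P n})%:R <= lambda%:R * n%:R ^ (d%:Z - 1) :> rat)) => [[d']|] E.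
  exists d'; last by exists P.
  by move: cP; rewrite /cx_resolution E lee_fin lez_nat.
by move: cP; rewrite /cx_resolution E.
Qed.

Lemma cx_algebra_le (k : fieldType) (A : falgType k) (d : nat) :
  (cx_algebra A <= d%:Z%:E)%E <->
  forall M : rmodule A, (cx_module M <= d%:Z%:E)%E.
Proof.
split=> [/least_or_oo_le[d' le cA] M|cA].
  by apply: le_trans (cA M) _; rewrite lee_fin lez_nat.
by apply/least_or_oo_le; exists d.
Qed.

(** Resolve [U (x)_A M] minimally over [B] and tensor with [N]: this resolves a
    module of which [U] is a retract, and the terms have grown by at most a
    factor that depends on [N] only. *)
Lemma separably_divides_cx (k : fieldType) (A B : falgType k) :
  separably_divides A B -> (cx_algebra A <= cx_algebra B)%E.
Proof.
move=> [M [N [[prM _] [prNl prNr] [X isoX]]]].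
have [DM] := left_dual_basis_of_projective prM.
have [DN] := left_dual_basis_of_projective prNl.
case: (least_or_ooP (fun d => forall M : rmodule B, (cx_module M <= d%:Z%:E)%E))
  => [[d]|] cB; rewrite /(cx_algebra B) cB ?leey //.
apply/cx_algebra_le => U.
have /cx_algebra_le/(_ (tensor DM U))/cx_module_le[Q _ cQ] :
  (cx_algebra B <= d%:Z%:E)%E by rewrite /cx_algebra cB.
have [i [p [iH pH pi1]]] := separable_retract DM DN U isoX.
have mP := cover_resolution_minimal U.
apply/cx_module_le; exists (cover_resolution U) => //.
apply: cx_resolution_le cQ => n.
apply: leq_trans (tensor_dim DN (Q n)).
exact: (minimal_resolution_dim (tensor_resolution DN prNr Q) iH pH pi1 mP).
Qed.

Theorem theorem1 (k : fieldType) (A B : falgType k) :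
  (separably_divides A B -> (cx_algebra A <= cx_algebra B)%E) /\
  (separably_equivalent A B -> cx_algebra A = cx_algebra B).
Proof.
split; first exact: separably_divides_cx.
move=> [M [N [prM prN isoX isoY]]].
apply/eqP; rewrite eq_le; apply/andP; split; apply: separably_divides_cx.
  by exists M, N; split.
by exists N, M; split.
Qed.
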